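(* Let $\mu_\varepsilon$ be a Borel probability measure on $\mathbb{R}$ and let $\eta$ be a finite non-negative Borel measure on $\mathbb{R}$ with $$\eta(\mathbb{R})<2\min\{(\eta*\mu_\varepsilon)(\{0\}),\,1\}.$$ Then the operator $\nu\mapsto\eta*\mu_\varepsilon*\nu$ is invertible (i.e. has a bounded linear inverse) on the Banach space $(\mathcal{M}(\mathbb{R},\mathcal{B}(\mathbb{R})),\|\cdot\|_{TV})$, and the operator $f\mapsto\big(\xi\mapsto\int_{\mathbb{R}}f(\xi-z)\,(\eta*\mu_\varepsilon)(dz)\big)$ is invertible on $(L^1(\mathbb{R}),\|\cdot\|_1)$.
   Context: $\mathcal{M}(\mathbb{R},\mathcal{B}(\mathbb{R}))$ is the space of finite signed Borel measures on $\mathbb{R}$ with total variation norm $\|\nu\|_{TV}:=|\nu|(\mathbb{R})$. Convolution of measures: $(\mu*\nu)(A):=\int\int\mathbf 1_A(x+y)\nu(dx)\mu(dy)$. *)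

(* Defs.v *)
From HB Require Import structures.
From mathcomp Require Import all_boot all_order all_algebra.
From mathcomp Require Import all_classical all_reals all_analysis.
Set Implicit Arguments. Unset Strict Implicit. Unset Printing Implicit Defensive.
Import Order.TTheory GRing.Theory Num.Theory.
Import numFieldNormedType.Exports.
Local Open Scope classical_set_scope.
Local Open Scope ring_scope.

Section defs.
Variable R : realType.

(* Elements of M(R, B(R)): real-valued countably additive set functions on
   the Borel sets of R (finite signed measures).  Values on non-Borel sets
   are irrelevant (only Borel sets are ever inspected). *)
Definition finite_signed_measure (nu : set R -> R) : Prop :=
  nu set0 = 0 /\
  forall F : nat -> set R, (forall n, measurable (F n)) -> trivIset setT F ->
    (fun n => \sum_(0 <= k < n) nu (F k)) @ \oo --> nu (\bigcup_n F n).

Definition meq (nu nu' : set R -> R) : Prop :=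
  forall A, measurable A -> nu A = nu' A.

Definition TVnorm (nu : set R -> R) : \bar R :=
  ereal_sup [set x : \bar R | exists (n : nat) (A : nat -> set R),
    [/\ forall i, measurable (A i),
        trivIset [set i | (i < n)%N] A,
        \bigcup_(i in [set i | (i < n)%N]) A i = setT &
        x = (\sum_(i < n) `|nu (A i)|)%:E]].

Definition mconv (m1 m2 : set R -> \bar R) : set R -> \bar R :=
  fun A => (\int[m1]_y (\int[m2]_x ((\1_A (x + y) : R)%:E)))%E.

(* Convolution of a non-negative finite measure rho with a signed measure nu:
   (rho * nu)(A) = \int \int 1_A(x+y) nu(dx) rho(dy)
                 = \int nu({x | x + y \in A}) rho(dy). *)
Definition sconv (rho : set R -> \bar R) (nu : set R -> R) : set R -> R :=
  fun A => fine (\int[rho]_y ((nu [set x | A (x + y)])%:E))%E.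

Definition fconv (rho : set R -> \bar R) (f : R -> R) : R -> R :=
  fun xi => fine (\int[rho]_z ((f (xi - z))%:E))%E.

Definition L1 (f : R -> R) : Prop := f \in Lfun (@lebesgue_measure R) 1%E.
Definition L1norm (f : R -> R) : \bar R :=
  ('N[@lebesgue_measure R]_1%E [EFin \o f])%E.

End defs.

(* Main.v *)
(** Write [rho = eta * mu_eps], [c = rho {0}] and [rho = c \d_0 + k].  As
    [mu_eps] is a probability, [rho] has mass [eta(R)], so the hypothesis says
    that [k] has mass less than [c], and the Neumann series
    [sum_n (-1)^n c^(-n-1) k^n] (convolution powers) converges in total variation to a
    convolution inverse of [rho].  Its even and odd terms sum to finite
    non-negative measures [p] and [q] with [rho * p = rho * q + \d_0], and
    convolution with [p] minus convolution with [q] inverts convolution with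
    [rho], both on signed measures (which reduce to differences of finite
    measures by the Jordan decomposition) and on L1 (by Fubini's theorem and
    translation invariance of the Lebesgue measure). *)
Require Import Defs.
From HB Require Import structures.
From mathcomp Require Import all_boot all_order all_algebra.
From mathcomp Require Import all_classical all_reals all_analysis.
From mathcomp Require Import measurable_realfun ring.
Import Order.TTheory GRing.Theory Num.Theory.
Import numFieldNormedType.Exports.
Local Open Scope classical_set_scope.
Local Open Scope ring_scope.

Local Notation pushforward_measure :=
  measure_function_pushforward__canonical__measure_function_Measure.

(** * Convolution of finite measures: measure structure, Tonelli, commutativity, associativity *)

Section mconv_measure.
Local Open Scope ereal_scope.
Context {R : realType}.
Implicit Types (m : {finite_measure set R -> \bar R}) (A : set R).
Implicit Types mu : {measure set R -> \bar R}.

Lemma measurable_addpair : measurable_fun [set: R * R] (fun z => z.1 + z.2)%R.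
Proof. exact: measurable_funD. Qed.

Lemma measurable_translate A (y : R) :
  measurable A -> measurable [set x | A (x + y)%R].
Proof.
move=> mA; rewrite -[X in measurable X]setTI.
by apply: (measurable_funD (@measurable_id _ _ setT) (measurable_cst y)).
Qed.

Lemma integral_indic_translate mu A (y : R) : measurable A ->
  \int[mu]_x (\1_A (x + y)%R)%:E = mu [set x | A (x + y)%R].
Proof.
move=> mA; rewrite -[X in mu X](setIT [set x | A (x + y)%R]).
by rewrite -integral_indic//; exact: measurable_translate.
Qed.

Lemma mconvE mu1 mu2 A : measurable A ->
  mconv mu1 mu2 A = \int[mu1]_y mu2 [set x | A (x + y)%R].
Proof.
by move=> mA; apply: eq_integral => y _; exact: integral_indic_translate.
Qed.

(** As the image of the product measure under addition, the convolution inherits countable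
    additivity and the change of variables formula. *)
Lemma mconv_pushforward m1 m2 A : measurable A ->
  mconv m1 m2 A = pushforward (m1 \x m2) (fun z : R * R => z.1 + z.2)%R A.
Proof.
move=> mA; rewrite mconvE// /pushforward /product_measure1.
apply: eq_integral => y _ /=; congr (m2 _).
by apply/seteqP; split => x; rewrite /xsection/= inE/= addrC.
Qed.

Let mconv0 m1 m2 : mconv m1 m2 set0 = 0.
Proof. by rewrite mconv_pushforward// /pushforward preimage_set0 measure0. Qed.

Let mconv_ge0 m1 m2 A : 0 <= mconv m1 m2 A.
Proof.
by apply: integral_ge0 => y _; apply: integral_ge0 => x _; rewrite lee_fin.
Qed.

Let mconv_sigma_additive m1 m2 : semi_sigma_additive (mconv m1 m2).
Proof.
move=> F mF tF mUF; rewrite mconv_pushforward//.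
under eq_fun do under eq_bigr do rewrite mconv_pushforward//.
exact: (@measure_semi_sigma_additive _ _ _
  (pushforward_measure (m1 \x m2) measurable_addpair)).
Qed.

HB.instance Definition _ m1 m2 := isMeasure.Build _ _ _ (mconv m1 m2)
  (mconv0 m1 m2) (mconv_ge0 m1 m2) (@mconv_sigma_additive m1 m2).

Lemma mconvT m1 m2 : mconv m1 m2 setT = m1 setT * m2 setT.
Proof.
rewrite mconvE//.
under eq_integral do rewrite (_ : [set x | _] = setT)//.
by rewrite integral_cst// muleC.
Qed.

Let mconv_fin m1 m2 : fin_num_fun (mconv m1 m2).
Proof.
apply: lty_fin_num_fun; rewrite [ltLHS]mconvT.
by rewrite -ge0_fin_numE ?mule_ge0// fin_numM// fin_num_measure.
Qed.

HB.instance Definition _ m1 m2 := Measure_isFinite.Build _ _ _ (mconv m1 m2)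
  (@mconv_fin m1 m2).

Lemma ge0_integral_mconv m1 m2 (f : R -> \bar R) : measurable_fun setT f ->
  (forall x, 0 <= f x) ->
  \int[mconv m1 m2]_z f z = \int[m1]_y \int[m2]_x f (x + y)%R.
Proof.
move=> mf f0.
rewrite (eq_measure_integral
    (pushforward_measure (m1 \x m2) measurable_addpair)); last first.
  by move=> A mA _; rewrite /= mconv_pushforward.
rewrite ge0_integral_pushforward//; last exact: measurable_addpair.
rewrite preimage_setT.
have mfD : measurable_fun setT (f \o (fun z : R * R => z.1 + z.2)%R).
  by apply: measurableT_comp => //; exact: measurable_addpair.
apply: etrans (fubini_tonelli1 (m1 := m1) (m2 := m2) _ mfD (fun=> f0 _)) _.
by apply: eq_integral => y _; apply: eq_integral => x _ /=; rewrite addrC.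
Qed.

(** Tonelli exchanges the two integrals of the indicator of [A] at the sum. *)
Lemma mconvC m1 m2 A : measurable A -> mconv m1 m2 A = mconv m2 m1 A.
Proof.
move=> mA; pose f (z : R * R) : \bar R := (\1_A (z.2 + z.1)%R)%:E.
have mf : measurable_fun setT f.
  apply/measurable_EFinP; apply: measurableT_comp; first exact: measurable_indic.
  exact: measurable_funD.
have f0 z : 0 <= f z by rewrite lee_fin.
apply: etrans (fubini_tonelli (m1 := m1) (m2 := m2) f mf f0) _.
by apply: eq_integral => y _; apply: eq_integral => x _; rewrite /f/= addrC.
Qed.

Lemma measurable_measure_translate m A : measurable A ->
  measurable_fun setT (fun y : R => m [set x | A (x + y)%R]).
Proof.
move=> mA.
rewrite (_ : (fun y => _) =
    fubini_F m (fun z : R * R => (\1_A (z.2 + z.1)%R)%:E)).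
  apply: measurable_fun_fubini_tonelli_F => //.
  apply/measurable_EFinP; apply: measurableT_comp; first exact: measurable_indic.
  exact: measurable_funD.
by apply/funext => y; rewrite /fubini_F/= integral_indic_translate.
Qed.

(** Both sides unfold to the integral over [y], then [x], of the [m3]-mass of [A] translated by
    [x + y]. *)
Lemma mconvA m1 m2 m3 A : measurable A ->
  mconv m1 (mconv m2 m3) A = mconv (mconv m1 m2) m3 A.
Proof.
move=> mA; rewrite [RHS]mconvE// ge0_integral_mconv//; last first.
  exact: measurable_measure_translate.
apply: etrans (mconvE m1 (mconv m2 m3) A mA) _; apply: eq_integral => y _.
rewrite [LHS]mconvE; last exact: measurable_translate.
by apply: eq_integral => x _; congr (m3 _); apply/funext => z /=; rewrite addrA.
Qed.

End mconv_measure.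

(** * Neumann series for the convolution inverse *)

Section convolution_inverse.
Local Open Scope ereal_scope.
Context {R : realType}.
Implicit Types (m : {finite_measure set R -> \bar R}) (A : set R).

(** Monotone convergence: the terms are non-negative, so the sum leaves the integral. *)
Lemma mconv_mseries m (s : {finite_measure set R -> \bar R}^nat) A :
  measurable A ->
  mconv m (mseries s 0) A = \sum_(0 <= n <oo) mconv m (s n) A.
Proof.
move=> mA; rewrite mconvE//.
rewrite integral_nneseries//.
  by apply: eq_eseriesr => n _; rewrite mconvE.
by move=> n; exact: measurable_measure_translate.
Qed.

Lemma mconv_dirac0l m A : measurable A -> mconv \d_(0%R : R) m A = m A.
Proof.
move=> mA; rewrite mconvE// integral_dirac//.
  rewrite diracT mul1e; congr (m _).
  by apply/seteqP; split => x /=; rewrite addr0.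
exact: measurable_measure_translate.
Qed.

(** Splits off the atom of [m] at 0, a multiple of [\d_0], which is neutral for convolution. *)
Lemma mconv_mrestrC0 m m' A : measurable A ->
  mconv m m' A = m [set 0%R] * m' A +
    mconv (mrestr m (measurableC (measurable_set1 (0%R : R)))) m' A.
Proof.
move=> mA.
have m0 : m [set 0%R] \is a fin_num by rewrite fin_num_measure.
have c0 : (0 <= fine (m [set 0%R]))%R by rewrite fine_ge0.
pose k := mrestr m (measurableC (measurable_set1 (0%R : R))).
pose mf := measurable_measure_translate m' A mA.
rewrite [LHS]mconvE// (eq_measure_integral
    (measure_add (mscale (NngNum c0) \d_(0%R : R)) k)).
  rewrite ge0_integral_measure_add// ge0_integral_mscale//= fineK//.
  by rewrite -(mconvE \d_(0%R : R) m')// mconv_dirac0l// -mconvE.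
move=> B mB _.
apply: (@etrans _ _
    (m [set 0%R] * \d_(0%R : R) B + m (B `&` ~` [set 0%R]))); last first.
  by rewrite [RHS]measure_addE -[in LHS](fineK m0).
rewrite diracE -[in LHS](setIT B) -(setUv [set 0%R]) setIUr.
rewrite measureU//; last 3 first.
- by apply: measurableI.
- by apply: measurableI => //; exact: measurableC.
- by rewrite setIACA setICr setI0.
(* The trace of [B] on the singleton of 0 is that singleton or empty. *)
congr (_ + _); case: (boolP (0%R \in B)) => [|] B0.
  rewrite mule1; congr (m _); apply/setIidPr => _ -> /=; exact: set_mem.
rewrite mule0 (_ : _ `&` _ = set0) ?measure0//.
by apply/seteqP; split => // x /= [Bx x0]; move: B0; rewrite -x0 mem_set.
Qed.

Lemma mseries_geometric_fin_num (s : {finite_measure set R -> \bar R}^nat)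
    (a r : R) : (0 <= a)%R -> (0 <= r < 1)%R ->
  (forall n, s n setT <= (a * r ^+ n)%:E) -> fin_num_fun (mseries s 0).
Proof.
move=> a0 /andP[r0 r1] sE; apply: lty_fin_num_fun.
apply: (@le_lt_trans _ _ (a / (1 - r))%:E); last exact: ltry.
apply: lime_le; first by apply: is_cvg_nneseries.
near=> n; apply: (@le_trans _ _ (\sum_(0 <= k < n) (a * r ^+ k)%:E)).
  by apply: lee_sum => k _; exact: sE.
have -> : \sum_(0 <= k < n) (a * r ^+ k)%:E = (series (geometric a r) n)%:E.
  by rewrite sumEFin.
rewrite lee_fin geometric_seriesE ?lt_eqF//= ler_pM2r ?invr_gt0 ?subr_gt0//.
by rewrite ler_piMr// gerBl exprn_ge0.
Unshelve. all: by end_near. Qed.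

(* The Neumann series of [m = c \d_0 + k], split into its even and odd terms
   so that only non-negative measures occur. *)
Lemma exists_mconv_inverse m : m setT < 2%:E * m [set 0%R] ->
  exists p q : {finite_measure set R -> \bar R}, forall A, measurable A ->
    mconv m p A = mconv m q A + \d_(0%R : R) A.
Proof.
move=> mlt.
pose k := mrestr m (measurableC (measurable_set1 (0%R : R))).
pose c := fine (m [set 0%R]).
have cE : m [set 0%R] = c%:E by rewrite fineK// fin_num_measure.
have mTE : m setT = c%:E + k setT.
  rewrite -cE /k /mrestr setTI -measureU ?setUv ?setICr//.
  exact: measurableC.
have kfin : k setT \is a fin_num by rewrite fin_num_measure.
have kT0 : (0 <= fine (k setT))%R by rewrite fine_ge0.
(* The hypothesis reads [c + k(R) < 2c]. *)
have kc : (fine (k setT) < c)%R.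
  move: mlt; rewrite mTE cE -(fineK kfin) -EFinD -EFinM lte_fin.
  by rewrite mulr_natl mulr2n ltrD2l.
have c0 : (0 < c)%R by exact: le_lt_trans kc.
have ci0 : (0 <= c^-1)%R by rewrite invr_ge0 ltW.
(* [t n] is the unsigned Neumann term [c^(-n-1) k^n], of mass [c^-1 r^n] with [r = k(R)/c]. *)
pose t := fix t n : {finite_measure set R -> \bar R} :=
  if n is n.+1 then mscale (NngNum ci0) (mconv k (t n))
  else mscale (NngNum ci0) \d_(0%R : R).
pose r := (fine (k setT) / c)%R.
have r01 : (0 <= r < 1)%R by rewrite divr_ge0 ?(ltW c0)//= ltr_pdivrMr// mul1r.
have tT n : t n setT = (c^-1 * r ^+ n)%:E.
  elim: n => [|n IH] /=; first by rewrite /mscale/= diracT mule1 expr0 mulr1.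
  rewrite -[LHS]/((c^-1)%:E * mconv k (t n) setT) mconvT IH.
  rewrite -[X in _ * (X * _)](fineK kfin) -!EFinM exprS /r.
  by rewrite -!mulrA.
have tS n A : measurable A -> mconv k (t n) A = c%:E * t n.+1 A.
  by move=> mA; rewrite /= /mscale/= muleA -EFinM divff ?gt_eqF// mul1e.
have [r0 r1] := andP r01.
(* Keeping every second term squares the ratio of the geometric bound. *)
have r2 : (0 <= r ^+ 2 < 1)%R by rewrite exprn_ge0//= exprn_ilt1.
have pfin : fin_num_fun (mseries (fun n => t n.*2) 0).
  apply: (mseries_geometric_fin_num _ _ _ ci0 r2) => n.
  by rewrite tT -exprM mul2n.
have qfin : fin_num_fun (mseries (fun n => t n.*2.+1) 0).
  apply: (mseries_geometric_fin_num _ _ _ (mulr_ge0 ci0 r0) r2) => n.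
  by rewrite tT -exprM mul2n exprS mulrA.
pose p : {finite_measure set R -> \bar R} :=
  HB.pack (mseries (fun n => t n.*2) 0)
  (Measure_isFinite.Build _ _ _ (mseries (fun n => t n.*2) 0) pfin).
pose q : {finite_measure set R -> \bar R} :=
  HB.pack (mseries (fun n => t n.*2.+1) 0)
  (Measure_isFinite.Build _ _ _ (mseries (fun n => t n.*2.+1) 0) qfin).
exists p, q => A mA.
(* Convolution with [k] sends each term to [c] times the next one, hence even terms to odd ones. *)
have kp : mconv k p A = c%:E * q A.
  rewrite [LHS]mconv_mseries// [RHS]/= /mseries -nneseriesZl//.
  by apply: eq_eseriesr => n _; exact: tS.
(* From odd to even the index starts at 2; the missing term is [c * t 0 = \d_0]. *)
have kq : mconv k q A + \d_(0%R : R) A = c%:E * p A.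
  rewrite [X in X + _]mconv_mseries// [X in _ = _ * X]/= /mseries -nneseriesZl//.
  have ct0 n : 0 <= c%:E * t n.*2 A by rewrite mule_ge0// lee_fin ltW.
  rewrite [RHS]nneseries_recl//; last by move=> n _; exact: ct0.
  rewrite addeC; congr (_ + _).
    rewrite -[RHS]/(c%:E * ((c^-1)%:E * \d_(0%R : R) A)).
    by rewrite muleA -(EFinM c) divff ?gt_eqF// mul1e.
  rewrite -[RHS](nneseries_addn 1)//.
  by apply: eq_eseriesr => n _; rewrite addn1 doubleS tS.
(* With [m = c \d_0 + k], both sides equal [c p + c q]. *)
rewrite [LHS](mconv_mrestrC0 m p A mA).
rewrite [X in _ = X + _](mconv_mrestrC0 m q A mA) cE.
by rewrite -addeA -/k kq kp addeC.
Qed.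

End convolution_inverse.

(** * Signed measures as differences of finite measures *)

Section signed_measures.
Context {R : realType}.
Implicit Types (m P N : {finite_measure set R -> \bar R}) (A : set R).
Implicit Types nu : set R -> R.

(** [P] and [N] may overlap, so that the relation survives convolution; the Jordan decomposition is
    one instance. *)
Definition represents nu P N :=
  forall A, measurable A -> nu A = fine (P A) - fine (N A).

Lemma represents_finite_signed_measure nu P N :
  represents nu P N -> finite_signed_measure nu.
Proof.
move=> nuE; split; first by rewrite nuE// !measure0 subrr.
move=> F mF tF; have mUF := bigcupT_measurable F mF.
have cvgf m : (fun n => \sum_(0 <= k < n) fine (m (F k))) @ \oo -->
    fine (m (\bigcup_n F n)).
  rewrite (_ : (fun n => _) = fine \o (fun n => \sum_(0 <= k < n) m (F k))%E).
    apply: fine_cvg; rewrite fineK ?fin_num_measure//.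
    exact: measure_semi_sigma_additive.
  apply/funext => n /=; rewrite -[LHS]/(fine (_%:E)) -sumEFin.
  by congr fine; apply: eq_bigr => k _; rewrite fineK// fin_num_measure.
rewrite nuE// (_ : (fun n => _) =
    (fun n => \sum_(0 <= k < n) fine (P (F k))) \-
    (fun n => \sum_(0 <= k < n) fine (N (F k)))).
  exact: cvgB (cvgf P) (cvgf N).
apply/funext => n /=; rewrite -sumrB.
by apply: eq_bigr => k _; rewrite nuE.
Qed.

(** On each cell of a partition [|nu|] is at most [P + N], and these bounds add up to the total
    masses. *)
Lemma TVnorm_represents nu P N : represents nu P N ->
  (TVnorm nu <= P setT + N setT)%E.
Proof.
move=> nuE; apply: ge_ereal_sup => _ /= [n [A [mA tA UA ->]]].
have massE m : m setT = (\sum_(i < n) (fine (m (A i))))%:E.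
  rewrite -sumEFin -UA bigcup_mkord measure_bigsetU_ord//; last first.
    by apply/trivIsetP => /= i j _ _ ij; move/trivIsetP: tA; apply => //=.
  by apply: eq_bigr => i _; rewrite fineK// fin_num_measure.
rewrite !massE -EFinD lee_fin -big_split/=; apply: ler_sum => i _.
rewrite nuE// (le_trans (ler_normB _ _))// !ger0_norm// fine_ge0//.
Qed.

Section jordan.
Variable nu : set R -> R.
Hypothesis nuP : finite_signed_measure nu.

Let c : set R -> \bar R := EFin \o nu.

Let c0 : c set0 = 0%E. Proof. by rewrite /c/= nuP.1. Qed.

Let c_fin A : measurable A -> c A \is a fin_num. Proof. by []. Qed.

Let c_sigma_additive : semi_sigma_additive c.
Proof.
move=> F mF tF mUF; rewrite /c/=; under eq_fun do rewrite sumEFin.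
by apply: cvg_EFin; [exact: nearW|exact: nuP.2].
Qed.

HB.instance Definition _ := isCharge.Build _ _ _ c c0 c_fin c_sigma_additive.

(** The Jordan parts are taken; the mass bound is what turns estimates on [P] and [N] into estimates
    by the norm of [nu]. *)
Lemma finite_signed_measure_represents : exists P N, represents nu P N /\
  (P setT + N setT <= TVnorm nu)%E.
Proof.
have [U [V UV]] := Hahn_decomposition c.
have nuE : represents nu (jordan_pos UV) (jordan_neg UV).
  move=> A mA; have := jordan_decomp UV mA.
  rewrite /cadd/= cscaleN1 => /(congr1 fine)/= ->.
  by rewrite fineB// fin_num_measure.
exists (jordan_pos UV), (jordan_neg UV); split => //.
have [[mU U0] [mV V0] UVT UV0] := UV.
have pT : jordan_pos UV setT = c U.
  by rewrite jordan_posE cjordan_posE /crestr0 mem_set// /crestr setTI.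
have nT : (jordan_neg UV setT = - c V)%E.
  by rewrite jordan_negE cjordan_negE /crestr0 mem_set// /crestr setTI.
(* The Hahn partition into [U] and [V] realises [P(R) + N(R)] as one of the sums in the supremum. *)
apply: ereal_sup_ubound; exists 2%N, (fun i => if i is 0%N then U else V).
split.
- by case.
- apply/trivIsetP => i j /= i2 j2.
  case: i i2 => [|[|i]]//; case: j j2 => [|[|j]]// _ _ _; last by rewrite setIC.
- rewrite -UVT; apply/seteqP; split => [x [i /=]|x [Ux|Vx]].
  + by case: i => [|[|i]]// _ ?; [left|right].
  + by exists 0%N.
  + by exists 1%N.
- rewrite big_ord_recl big_ord1/= pT nT -EFinN -EFinD; congr EFin.
  have := U0 U mU (@subset_refl _ _); have := V0 V mV (@subset_refl _ _).
  by rewrite !lee_fin => v0 u0; rewrite ger0_norm// ler0_norm.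
Qed.

End jordan.

(** The function is non-negative and its integral is the finite number [mconv m m' A]. *)
Lemma integrable_measure_translate m m' A : measurable A ->
  m.-integrable setT (fun y => m' [set x | A (x + y)]).
Proof.
move=> mA; apply/integrableP; split; first exact: measurable_measure_translate.
under eq_integral do rewrite gee0_abs//.
by rewrite -mconvE// -ge0_fin_numE// fin_num_measure.
Qed.

Lemma represents_translate nu P N A (y : R) : represents nu P N ->
  measurable A -> (nu [set x | A (x + y)])%:E =
  (P [set x | A (x + y)%R] - N [set x | A (x + y)%R])%E.
Proof.
move=> nuE mA; have mAy := measurable_translate A y mA.
by rewrite nuE// EFinB !fineK// fin_num_measure.
Qed.

Lemma represents_translate_integrable m nu P N A : represents nu P N ->
  measurable A ->
  m.-integrable setT (EFin \o (fun y => nu [set x | A (x + y)])).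
Proof.
move=> nuE mA.
have iP := integrable_measure_translate m P A mA.
have iN := integrable_measure_translate m N A mA.
apply: eq_integrable (integrableB _ iP iN) => // y _.
exact/esym/represents_translate.
Qed.

Lemma represents_sconv m nu P N : represents nu P N ->
  represents (sconv m nu) (mconv m P) (mconv m N).
Proof.
move=> nuE A mA.
have iP := integrable_measure_translate m P A mA.
have iN := integrable_measure_translate m N A mA.
have mE m' : fine (mconv m m' A) = fine (\int[m]_y m' [set x | A (x + y)%R])%E.
  by rewrite mconvE.
rewrite [X in _ = X - _](mE P) [X in _ = _ - X](mE N) -fineB; last 2 first.
- exact: integrable_fin_num.
- exact: integrable_fin_num.
rewrite -integralB//; congr fine; apply: eq_integral => y _.
exact: represents_translate.
Qed.

(** Representations of [nu] and [nu'] supply the integrability behind additivity of the integral. *)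
Lemma sconv_linear m (a b : R) nu nu' : finite_signed_measure nu ->
  finite_signed_measure nu' ->
  meq (sconv m (fun A => a * nu A + b * nu' A))
      (fun A => a * sconv m nu A + b * sconv m nu' A).
Proof.
move=> /finite_signed_measure_represents[P [N [nuE _]]].
move=> /finite_signed_measure_represents[P' [N' [nuE' _]]] A mA.
have i1 := represents_translate_integrable m nu P N A nuE mA.
have i2 := represents_translate_integrable m nu' P' N' A nuE' mA.
rewrite /sconv -!/(Rintegral _ _ _).
rewrite RintegralD//; first by rewrite !RintegralZl.
- by apply: eq_integrable (integrableZl _ a i1).
- by apply: eq_integrable (integrableZl _ b i2).
Qed.

End signed_measures.

(** * Sums of finite measures are finite *)

Section measure_add_finite.
Context {R : realType}.
Implicit Types (m : {finite_measure set R -> \bar R}).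

Let measure_add_fin m1 m2 : fin_num_fun (measure_add m1 m2).
Proof.
move=> A mA; have -> : measure_add m1 m2 A = (m1 A + m2 A)%E.
  exact: measure_addE.
by rewrite fin_numD !fin_num_measure.
Qed.

HB.instance Definition _ m1 m2 := Measure.on (measure_add m1 m2).

HB.instance Definition _ m1 m2 :=
  Measure_isFinite.Build _ _ _ (measure_add m1 m2) (@measure_add_fin m1 m2).

End measure_add_finite.

(** * The inverse operator on signed measures *)

Section inverse_on_measures.
Context {R : realType}.
Variables rho p q : {finite_measure set R -> \bar R}.
Hypothesis rhopq : forall A, measurable A ->
  (mconv rho p A = mconv rho q A + \d_(0%R : R) A)%E.
Implicit Types (m P N : {finite_measure set R -> \bar R}) (A : set R).
Implicit Types nu : set R -> R.

Lemma eq_mconvl m1 m2 m A : measurable A ->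
  (forall B, measurable B -> m1 B = m2 B) -> mconv m1 m A = mconv m2 m A.
Proof.
move=> mA m12; rewrite [LHS]mconvE// [RHS]mconvE//.
by apply: eq_measure_integral => B mB _; exact: m12.
Qed.

Lemma mconv_measure_addl m1 m2 m A : measurable A ->
  mconv (measure_add m1 m2) m A = (mconv m1 m A + mconv m2 m A)%E.
Proof.
move=> mA; rewrite [LHS]mconvE// ge0_integral_measure_add//.
  by rewrite -!mconvE.
exact: measurable_measure_translate.
Qed.

(** Convolve the identity [rho * p = rho * q + \d_0] with [m] and reassociate. *)
Lemma mconv_inverser m A : measurable A ->
  mconv rho (mconv p m) A = (mconv rho (mconv q m) A + m A)%E.
Proof.
move=> mA; rewrite [LHS]mconvA// [X in _ = (X + _)%E]mconvA//.
rewrite [LHS](eq_mconvl _ (measure_add (mconv rho q) \d_(0%R : R)) m A mA).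
  rewrite [LHS]mconv_measure_addl//; congr (_ + _)%E.
  exact: mconv_dirac0l.
by move=> B mB; rewrite [RHS]measure_addE; exact: rhopq.
Qed.

Lemma mconvCA m1 m2 m A : measurable A ->
  mconv m1 (mconv m2 m) A = mconv m2 (mconv m1 m) A.
Proof.
move=> mA; rewrite [LHS]mconvA// [RHS]mconvA//; apply: eq_mconvl => // B mB.
exact: mconvC.
Qed.

Lemma mconv_inversel m A : measurable A ->
  mconv p (mconv rho m) A = (mconv q (mconv rho m) A + m A)%E.
Proof.
move=> mA; rewrite [LHS]mconvCA// [X in _ = (X + _)%E]mconvCA//.
exact: mconv_inverser.
Qed.

(** This is convolution with the signed measure [p - q], kept as a difference because the first
    argument of [sconv] is a non-negative measure. *)
Definition sconv_inverse nu : set R -> R := fun A => sconv p nu A - sconv q nu A.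

(** Expand [(p - q) * (P - N)] and collect the terms by sign. *)
Lemma represents_sconv_inverse nu P N : represents nu P N ->
  represents (sconv_inverse nu)
    (measure_add (mconv p P) (mconv q N)) (measure_add (mconv p N) (mconv q P)).
Proof.
move=> nuE A mA; rewrite /sconv_inverse.
rewrite (represents_sconv p _ _ _ nuE A mA) (represents_sconv q _ _ _ nuE A mA).
rewrite [X in _ = fine X - _]measure_addE [X in _ = _ - fine X]measure_addE.
have fineDA m m' : fine (m A + m' A)%E = fine (m A) + fine (m' A).
  by apply: fineD; exact: fin_num_measure.
rewrite [X in _ = X - _]fineDA [X in _ = _ - X]fineDA.
by ring.
Qed.

Lemma finite_signed_measure_sconv m nu :
  finite_signed_measure nu -> finite_signed_measure (sconv m nu).
Proof.
move=> /finite_signed_measure_represents[P [N [nuE _]]].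
exact: (represents_finite_signed_measure _ _ _ (represents_sconv m _ _ _ nuE)).
Qed.

Lemma finite_signed_measure_sconv_inverse nu :
  finite_signed_measure nu -> finite_signed_measure (sconv_inverse nu).
Proof.
move=> /finite_signed_measure_represents[P [N [nuE _]]].
exact: (represents_finite_signed_measure _ _ _
  (represents_sconv_inverse _ _ _ nuE)).
Qed.

Lemma sconv_inverse_linear (a b : R) nu nu' :
  finite_signed_measure nu -> finite_signed_measure nu' ->
  meq (sconv_inverse (fun A => a * nu A + b * nu' A))
      (fun A => a * sconv_inverse nu A + b * sconv_inverse nu' A).
Proof.
move=> fnu fnu' A mA; rewrite /sconv_inverse.
rewrite (sconv_linear p a b nu nu' fnu fnu' A mA).
rewrite (sconv_linear q a b nu nu' fnu fnu' A mA).
by rewrite !mulrBr opprD addrACA.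
Qed.

(** The masses of the four convolutions sum to [(p(R) + q(R)) (P(R) + N(R))], and for the Jordan
    parts the second factor is at most the norm of [nu]. *)
Lemma TVnorm_sconv_inverse nu : finite_signed_measure nu ->
  (TVnorm (sconv_inverse nu) <= (fine (p setT + q setT))%:E * TVnorm nu)%E.
Proof.
move=> /finite_signed_measure_represents[P [N [nuE PN]]].
apply: le_trans (TVnorm_represents _ _ _ (represents_sconv_inverse _ _ _ nuE)) _.
have pqfin : (p setT + q setT)%E \is a fin_num by rewrite fin_numD !fin_num_measure.
rewrite [X in (X + _ <= _)%E]measure_addE [X in (_ + X <= _)%E]measure_addE.
rewrite [X in (X + _ + _ <= _)%E]mconvT [X in (_ + X + _ <= _)%E]mconvT.
rewrite [X in (_ + (X + _) <= _)%E]mconvT [X in (_ + (_ + X) <= _)%E]mconvT fineK//.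
apply: le_trans (lee_wpmul2l _ PN); last by rewrite adde_ge0.
have fE m : m setT = (fine (m setT))%:E by rewrite fineK// fin_num_measure.
rewrite (fE p) (fE q) (fE P) (fE N) -?EFinM -?EFinD -?EFinM -?EFinD lee_fin.
by rewrite le_eqVlt; apply/orP; left; apply/eqP; ring.
Qed.

(** Apply [mconv_inversel] to both Jordan parts; the [q] terms cancel. *)
Lemma sconvK nu : finite_signed_measure nu ->
  meq (sconv_inverse (sconv rho nu)) nu.
Proof.
move=> /finite_signed_measure_represents[P [N [nuE _]]] A mA.
have rE := represents_sconv rho _ _ _ nuE.
rewrite /sconv_inverse.
rewrite (represents_sconv p _ _ _ rE A mA) (represents_sconv q _ _ _ rE A mA).
rewrite [X in fine X - _ - _](mconv_inversel P A mA).
rewrite [X in _ - fine X - _](mconv_inversel N A mA).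
have fineDA m m' : fine (m A + m' A)%E = fine (m A) + fine (m' A).
  by apply: fineD; exact: fin_num_measure.
rewrite [X in X - _ - _]fineDA [X in _ - X - _]fineDA.
have cancel (a b x y : R) : a + x - (b + y) - (a - b) = x - y by ring.
by rewrite nuE// cancel.
Qed.

Lemma sconv_inverseK nu : finite_signed_measure nu ->
  meq (sconv rho (sconv_inverse nu)) nu.
Proof.
move=> fnu A mA.
have fp := finite_signed_measure_sconv p nu fnu.
have fq := finite_signed_measure_sconv q nu fnu.
(* The form required to move [sconv rho] inside the difference by [sconv_linear]. *)
have -> : sconv_inverse nu = (fun A => 1 * sconv p nu A + (-1) * sconv q nu A).
  by apply/funext => B; rewrite mul1r mulN1r.
rewrite (sconv_linear rho 1 (-1) _ _ fp fq A mA) mul1r mulN1r.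
have [P [N [nuE _]]] := finite_signed_measure_represents nu fnu.
rewrite (represents_sconv rho _ _ _ (represents_sconv p _ _ _ nuE) A mA).
rewrite (represents_sconv rho _ _ _ (represents_sconv q _ _ _ nuE) A mA).
rewrite [X in fine X - _ - _](mconv_inverser P A mA).
rewrite [X in _ - fine X - _](mconv_inverser N A mA).
have fineDA m m' : fine (m A + m' A)%E = fine (m A) + fine (m' A).
  by apply: fineD; exact: fin_num_measure.
rewrite [X in X - _ - _]fineDA [X in _ - X - _]fineDA.
have cancel (a b x y : R) : a + x - (b + y) - (a - b) = x - y by ring.
by rewrite nuE// cancel.
Qed.

End inverse_on_measures.

(** * Fubini for integrals against a convolution *)

Section integral_mconv.
Local Open Scope ereal_scope.
Context {R : realType}.
Implicit Types (m : {finite_measure set R -> \bar R}).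

(** The inner [fine] matches the shape of an iterated [fconv]; it alters the inner integral at most
    on an [m1]-null set. *)
Lemma integral_mconv m1 m2 (h : R -> \bar R) :
  (mconv m1 m2).-integrable setT h ->
  \int[mconv m1 m2]_z h z = \int[m1]_y (fine (\int[m2]_x h (y + x)%R))%:E.
Proof.
move=> /[dup] ih /integrableP[mh hoo].
pose g (z : R * R) := h (z.1 + z.2)%R.
have mg : measurable_fun setT g.
  by apply: measurableT_comp mh _; exact: measurable_addpair.
have tonelli (k : R -> \bar R) : measurable_fun setT k -> (forall x, 0 <= k x) ->
    \int[mconv m1 m2]_z k z = \int[m1]_y \int[m2]_x k (y + x)%R.
  move=> mk k0; rewrite [LHS](ge0_integral_mconv _ _ _ mk k0).
  by apply: eq_integral => y _; apply: eq_integral => x _; rewrite addrC.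
have ig : (m1 \x m2).-integrable setT g.
  apply/integrable12ltyP => //.
  rewrite -(tonelli (fun z => `|h z|))//.
  exact: measurableT_comp.
have prodE (k : R -> \bar R) : measurable_fun setT k -> (forall x, 0 <= k x) ->
    \int[mconv m1 m2]_z k z = \int[m1 \x m2]_z k (z.1 + z.2)%R.
  move=> mk k0; rewrite tonelli//.
  apply: esym; apply: (fubini_tonelli1 (m1 := m1) (m2 := m2)
    (fun z => k (z.1 + z.2)%R)) => //.
  by apply: measurableT_comp mk _; exact: measurable_addpair.
(* Change of variables is available for non-negative functions, hence for the positive and negative
   parts of [h]. *)
have -> : \int[mconv m1 m2]_z h z = \int[m1 \x m2]_z g z.
  rewrite integralE [RHS]integralE; congr (_ - _).
    apply: etrans (prodE h^\+ (measurable_funepos mh) _) _ => //.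
    by apply: eq_integral => z _; rewrite /g !funeposE.
  apply: etrans (prodE h^\- (measurable_funeneg mh) _) _ => //.
  by apply: eq_integral => z _; rewrite /g !funenegE.
have iF := integrable_fubini_F ig.
have mF := measurable_int _ iF.
rewrite -(integral12_prod_meas1 ig); apply: ae_eq_integral => //.
  by apply/measurable_EFinP; apply: measurableT_comp => //.
apply: filterS (integrable_ae measurableT iF) => y /= yfin _.
by rewrite fineK//; exact: yfin.
Qed.

End integral_mconv.

#[global] Instance lebesgue_ae_filter (R : realType) :
  Filter (nbhs (almost_everywhere (@lebesgue_measure R))).
Proof. exact: ae_filter_ringOfSetsType. Qed.

(** * Convolution of a finite measure with an L1 function *)

Section fconv_L1.
Context {R : realType}.
Implicit Types (m : {finite_measure set R -> \bar R}) (f g : R -> R).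
Local Notation leb := (@lebesgue_measure R).

(** By uniqueness of Lebesgue measure it is enough to compare lengths of half-open intervals. *)
Lemma lebesgue_measure_translate (z : R) (A : set R) : measurable A ->
  leb A = leb [set x | A (x - z)].
Proof.
move=> mA.
have mz : measurable_fun setT
    (fun x : measurableTypeR R => (x - z : measurableTypeR R)).
  exact: measurable_funB.
pose mu := pushforward_measure leb mz.
rewrite -[RHS]/(mu A).
apply: (@lebesgue_measure_unique _ mu) => // _ [[a b] _ <-].
rewrite [RHS](_ : _ = leb [set` `]a + z, b + z]%R]).
  rewrite !lebesgue_measure_itv/= !lte_fin ltrD2r.
  by case: ifPn => // _; rewrite -!EFinB; congr EFin; ring.
rewrite /mu/= /pushforward; congr leb; apply/seteqP; split => x /=;
  by rewrite !in_itv/= ltrBrDr lerBlDr.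
Qed.

Lemma ge0_integral_translate (f : R -> \bar R) (z : R) :
  measurable_fun setT f -> (forall x, 0 <= f x)%E ->
  (\int[leb]_x f (x - z)%R = \int[leb]_x f x)%E.
Proof.
move=> mf f0.
have mz : measurable_fun setT
    (fun x : measurableTypeR R => (x - z : measurableTypeR R)).
  exact: measurable_funB.
rewrite [RHS](eq_measure_integral (pushforward_measure leb mz)).
  by rewrite ge0_integral_pushforward.
by move=> A mA _; exact: lebesgue_measure_translate.
Qed.

Lemma L1_integrable f : L1 f <-> leb.-integrable setT (EFin \o f).
Proof. by split=> /Lfun1_integrable. Qed.

Lemma L1_measurable f : L1 f -> measurable_fun setT f.
Proof. by move=> /L1_integrable/integrableP[/measurable_EFinP]. Qed.

Lemma L1norm_lty f : L1 f -> (L1norm f < +oo)%E.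
Proof. by move=> /L1_integrable/integrableP[_]; rewrite /L1norm Lnorm1. Qed.

Lemma measurable_subpair f : measurable_fun setT f ->
  measurable_fun [set: R * R] (fun z => (f (z.1 - z.2))%:E).
Proof.
move=> mf; apply/measurable_EFinP; apply: measurableT_comp mf _.
exact: measurable_funB.
Qed.

(** Tonelli and translation invariance. This yields both the integrability of [f (x - z)] on the
    product and the norm bound for [fconv]. *)
Lemma integral_abs_translate m f : measurable_fun setT f ->
  (\int[leb]_x \int[m]_z `|(f (x - z)%R)%:E| = m setT * L1norm f)%E.
Proof.
move=> mf; have mf2 := measurable_subpair f mf.
rewrite (fubini_tonelli (m1 := leb) (m2 := m)
    (fun z : R * R => `|(f (z.1 - z.2)%R)%:E|%E))//; last first.
  exact: measurableT_comp.
have mabs : measurable_fun setT (fun x => `|(f x)%:E|%E).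
  by apply: measurableT_comp => //; exact/measurable_EFinP.
under eq_integral => z _ do rewrite (ge0_integral_translate _ z mabs)//.
by rewrite integral_cst// muleC /L1norm Lnorm1.
Qed.

Lemma integrable_subpair m f : L1 f ->
  (leb \x m)%E.-integrable setT (fun z : R * R => (f (z.1 - z.2))%:E).
Proof.
move=> Lf; have mf := L1_measurable f Lf.
apply/integrable12ltyP; first exact: measurable_subpair.
rewrite integral_abs_translate// lte_mul_pinfty//.
- by rewrite fin_num_measure.
- exact: L1norm_lty.
Qed.

(** For almost every [x] the integral defining [fconv m f x] converges absolutely; elsewhere [fine]
    may return a default value, so the identities below are stated almost everywhere. *)
Lemma ae_integrable_translate m f : L1 f ->
  {ae leb, forall x, m.-integrable setT (fun z => (f (x - z))%:E)}.
Proof.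
by move=> /(integrable_subpair m)/ae_integrable1; apply; exact: measurable_int.
Qed.

Lemma measurable_fconv m f : L1 f -> measurable_fun setT (fconv m f).
Proof.
move=> /(integrable_subpair m) ifm; apply: measurableT_comp => //.
exact: (measurable_fubini_F ifm).
Qed.

Lemma L1norm_fconv m f : L1 f -> (L1norm (fconv m f) <= m setT * L1norm f)%E.
Proof.
move=> Lf; have mf := L1_measurable f Lf; rewrite -integral_abs_translate//.
rewrite /L1norm Lnorm1; apply: ge0_le_integral => //.
- apply: measurableT_comp => //; apply/measurable_EFinP.
  exact: measurable_fconv.
- apply: (measurable_fun_fubini_tonelli_F
    (fun z : R * R => `|(f (z.1 - z.2)%R)%:E|%E)) => //.
  by apply: measurableT_comp => //; exact: measurable_subpair.
- move=> x _; rewrite /fconv/=.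
  have mfx : measurable_fun setT (fun z : R => (f (x - z))%:E).
    apply/measurable_EFinP; apply: measurableT_comp mf _; exact: measurable_funB.
  apply: le_trans (le_abse_integral m measurableT mfx).
  (* An infinite integral becomes 0 under [fine], so the bound holds at every [x]. *)
  by case: (\int[m]_z _)%E => [r| |] /=; rewrite ?lexx// normr0 leey.
Qed.

Lemma L1_fconv m f : L1 f -> L1 (fconv m f).
Proof.
move=> Lf; apply/L1_integrable/integrableP; split.
  by apply/measurable_EFinP; exact: measurable_fconv.
have := L1norm_fconv m f Lf; rewrite /L1norm Lnorm1 => /le_lt_trans; apply.
rewrite lte_mul_pinfty//; first by rewrite fin_num_measure.
exact: L1norm_lty.
Qed.

Lemma L1_linear (a b : R) f g : L1 f -> L1 g -> L1 (fun x => a * f x + b * g x).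
Proof.
move=> /L1_integrable iF /L1_integrable iG; apply/L1_integrable.
by apply: eq_integrable (integrableD _ (integrableZl _ a iF) (integrableZl _ b iG)).
Qed.

Lemma fconv_linear m (a b : R) f g : L1 f -> L1 g ->
  fconv m (fun x => a * f x + b * g x) =
  (fun x => a * fconv m f x + b * fconv m g x) %[ae leb].
Proof.
move=> Lf Lg.
apply: filterS2 (ae_integrable_translate m f Lf) (ae_integrable_translate m g Lg).
move=> x iF iG _; rewrite /fconv -!/(Rintegral _ _ _).
rewrite RintegralD//; first by rewrite !RintegralZl.
- by apply: eq_integrable (integrableZl _ a iF).
- by apply: eq_integrable (integrableZl _ b iG).
Qed.

(** Wherever [z] maps to an integrable [f (x - z)] for [mconv m1 m2], Fubini in the form of
    [integral_mconv] applies. *)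
Lemma fconv_fconv m1 m2 f : L1 f ->
  fconv m1 (fconv m2 f) = fconv (mconv m1 m2) f %[ae leb].
Proof.
move=> Lf; apply: filterS (ae_integrable_translate (mconv m1 m2) f Lf) => x ix _.
apply: (@etrans _ _ (fine (\int[m1]_y
    (fine (\int[m2]_z (f (x - (y + z))%R)%:E))%:E)%E)); last first.
  by congr fine; exact/esym/integral_mconv.
congr fine; apply: eq_integral => y _; congr (fine _)%:E.
by apply: eq_integral => z _; rewrite opprD addrA.
Qed.

End fconv_L1.

(** * The inverse operator on L1 *)

Section inverse_on_L1.
Context {R : realType}.
Variables rho p q : {finite_measure set R -> \bar R}.
Hypothesis rhopq : forall A, measurable A ->
  (mconv rho p A = mconv rho q A + \d_(0%R : R) A)%E.
Implicit Types (m : {finite_measure set R -> \bar R}) (f g : R -> R).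
Local Notation leb := (@lebesgue_measure R).

Definition fconv_inverse f : R -> R := fun x => fconv p f x - fconv q f x.

Lemma L1_fconv_inverse f : L1 f -> L1 (fconv_inverse f).
Proof.
move=> Lf; have := L1_linear 1 (-1) _ _ (L1_fconv p f Lf) (L1_fconv q f Lf).
by congr L1; apply/funext => x; rewrite mul1r mulN1r.
Qed.

Lemma fconv_inverse_linear (a b : R) f g : L1 f -> L1 g ->
  fconv_inverse (fun x => a * f x + b * g x) =
  (fun x => a * fconv_inverse f x + b * fconv_inverse g x) %[ae leb].
Proof.
move=> Lf Lg.
apply: filterS2 (fconv_linear p a b f g Lf Lg) (fconv_linear q a b f g Lf Lg).
move=> x px qx _; rewrite /fconv_inverse px// qx//.
by rewrite !mulrBr opprD addrACA.
Qed.

Lemma L1norm_fconv_inverse f : L1 f ->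
  (L1norm (fconv_inverse f) <= (fine (p setT + q setT))%:E * L1norm f)%E.
Proof.
move=> Lf.
have mp : measurable_fun setT (EFin \o fconv p f).
  by apply/measurable_EFinP; exact: measurable_fconv.
have mq : measurable_fun setT (EFin \o fconv q f).
  by apply/measurable_EFinP; exact: measurable_fconv.
apply: (@le_trans _ _ (L1norm (fconv p f) + L1norm (fconv q f))%E).
  rewrite /L1norm !Lnorm1 -ge0_integralD//; last 2 first.
  - exact: measurableT_comp.
  - exact: measurableT_comp.
  apply: ge0_le_integral => //.
  - apply: measurableT_comp => //; apply/measurable_EFinP.
    by apply: L1_measurable; exact: L1_fconv_inverse.
  - by apply: emeasurable_funD; exact: measurableT_comp.
  - by move=> x _; rewrite /= lee_fin ler_normB.
rewrite fineK; last by rewrite fin_numD !fin_num_measure.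
by rewrite ge0_muleDl//; apply: leeD; exact: L1norm_fconv.
Qed.

(** The Dirac mass contributes [f (x - 0)]; the [m2] integral can be subtracted because it is finite
    for almost every [x]. *)
Lemma fconv_cancel m1 m2 f :
  (forall A, measurable A -> m1 A = (m2 A + \d_(0%R : R) A)%E) -> L1 f ->
  (fun x => fconv m1 f x - fconv m2 f x) = f %[ae leb].
Proof.
move=> m12 Lf; have mf := L1_measurable f Lf.
apply: filterS (ae_integrable_translate m2 f Lf) => x i2 _.
have mfx : measurable_fun setT (fun z : R => (f (x - z))%:E).
  by apply/measurable_EFinP; apply: measurableT_comp mf _; exact: measurable_funB.
have id0 : (\d_(0%R : R)).-integrable setT (fun z : R => (f (x - z))%:E).
  apply/integrableP; split => //; rewrite integral_dirac//.
    by rewrite diracT mul1e ltry.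
  exact: measurableT_comp.
rewrite /fconv (eq_measure_integral (measure_add m2 \d_(0%R : R))); last first.
  by move=> A mA _; rewrite [RHS]measure_addE; exact: m12.
rewrite integral_measure_add// integral_dirac// diracT mul1e fineD//.
  by rewrite subr0 /= addrAC subrr add0r.
exact: integrable_fin_num.
Qed.

(** Iterated convolutions merge into [p * rho] and [q * rho], which by commutativity differ by
    [\d_0]. *)
Lemma fconvK f : L1 f -> fconv_inverse (fconv rho f) = f %[ae leb].
Proof.
move=> Lf.
have rhopq' A : measurable A ->
    mconv p rho A = (mconv q rho A + \d_(0%R : R) A)%E.
  by move=> mA; rewrite mconvC// rhopq// mconvC.
apply: filterS3 (fconv_cancel (mconv p rho) (mconv q rho) f rhopq' Lf)
  (fconv_fconv p rho f Lf) (fconv_fconv q rho f Lf).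
by move=> x xE px qx _; rewrite /fconv_inverse px// qx// xE.
Qed.

Lemma fconv_inverseK f : L1 f -> fconv rho (fconv_inverse f) = f %[ae leb].
Proof.
move=> Lf.
have -> : fconv_inverse f = (fun x => 1 * fconv p f x + (-1) * fconv q f x).
  by apply/funext => x; rewrite mul1r mulN1r.
have lin := fconv_linear rho 1 (-1) _ _ (L1_fconv p f Lf) (L1_fconv q f Lf).
apply: filterS3 (filterI lin (fconv_cancel (mconv rho p) (mconv rho q) f rhopq Lf))
  (fconv_fconv rho p f Lf) (fconv_fconv rho q f Lf).
by move=> x [lx xE] px qx _; rewrite lx// px// qx// mul1r mulN1r xE.
Qed.

End inverse_on_L1.

Theorem theorem4 (R : realType) (mu_eps : probability R R)
    (eta : {finite_measure set R -> \bar R}) :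
  (eta [set: R] < 2%:E * Order.min (mconv eta mu_eps [set 0%R]) 1%E)%E ->
  let rho := mconv eta mu_eps in
  (* (i) nu |-> eta * mu_eps * nu is invertible on (M(R,B(R)), ||.||_TV) *)
  ((forall nu, finite_signed_measure nu ->
      finite_signed_measure (sconv rho nu)) /\
   exists S : (set R -> R) -> (set R -> R),
     [/\ forall nu, finite_signed_measure nu -> finite_signed_measure (S nu),
         forall (a b : R) nu nu', finite_signed_measure nu ->
           finite_signed_measure nu' ->
           meq (S (fun A => a * nu A + b * nu' A))
               (fun A => a * S nu A + b * S nu' A),
         exists C : R, forall nu, finite_signed_measure nu ->
           (TVnorm (S nu) <= C%:E * TVnorm nu)%E,
         forall nu, finite_signed_measure nu -> meq (S (sconv rho nu)) nu &
         forall nu, finite_signed_measure nu -> meq (sconv rho (S nu)) nu])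
  /\
  (* (ii) f |-> (xi |-> \int f(xi - z) (eta * mu_eps)(dz)) is invertible on L^1(R) *)
  ((forall f, L1 f -> L1 (fconv rho f)) /\
   exists S : (R -> R) -> (R -> R),
     [/\ forall f, L1 f -> L1 (S f),
         forall (a b : R) f g, L1 f -> L1 g ->
           S (fun x => a * f x + b * g x) = (fun x => a * S f x + b * S g x)
             %[ae (@lebesgue_measure R)],
         exists C : R, forall f, L1 f -> (L1norm (S f) <= C%:E * L1norm f)%E,
         forall f, L1 f -> S (fconv rho f) = f %[ae (@lebesgue_measure R)] &
         forall f, L1 f -> fconv rho (S f) = f %[ae (@lebesgue_measure R)]]).
Proof.
move=> lt_eta rho.
have rhoT : mconv eta mu_eps setT = eta setT.
  by rewrite mconvT [X in (_ * X)%E]probability_setT mule1.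
(* The minimum is at most its first entry, the mass of [rho] at 0. *)
have rho0 : (mconv eta mu_eps setT < 2%:E * mconv eta mu_eps [set 0%R])%E.
  rewrite rhoT (lt_le_trans lt_eta)// lee_pmul2l//.
  by rewrite ge_min lexx.
(* One pair [p], [q] serves both spaces, with the same constant [p(R) + q(R)]. *)
have [p [q rhopq]] := exists_mconv_inverse (mconv eta mu_eps) rho0.
split; split.
- by move=> nu; exact: finite_signed_measure_sconv.
- exists (sconv_inverse p q); split.
  + by move=> nu; exact: finite_signed_measure_sconv_inverse.
  + by move=> a b nu nu'; exact: sconv_inverse_linear.
  + by exists (fine (p setT + q setT)%E) => nu; exact: TVnorm_sconv_inverse.
  + by move=> nu; exact: (sconvK _ _ _ rhopq).
  + by move=> nu; exact: (sconv_inverseK _ _ _ rhopq).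
- by move=> f; exact: L1_fconv.
- exists (fconv_inverse p q); split.
  + by move=> f; exact: L1_fconv_inverse.
  + by move=> a b f g; exact: fconv_inverse_linear.
  + by exists (fine (p setT + q setT)%E) => f; exact: L1norm_fconv_inverse.
  + by move=> f; exact: (fconvK _ _ _ rhopq).
  + by move=> f; exact: (fconv_inverseK _ _ _ rhopq).
Qed.
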